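(* Let $K$ be an integer-valued random variable parameterized by $\theta\in\Theta$. Let $L(K)$ and $U(K)$ be functions of the random variable $K$. Let $[a,b]$ be an interval contained in $\Theta$. Let $\mathcal{S}_L$ denote the intersection of the interval $(a,b)$ and the support of $L(K)$, and let $\mathcal{S}_U$ denote the intersection of the interval $(a,b)$ and the support of $U(K)$. Suppose that, for any $\vartheta\in\Theta$, $\Pr\{L(K)\le\vartheta\le U(K)\mid\theta\}$ is a continuous and unimodal function of $\theta\in\Theta$. Define $$C_L(\theta)=\Pr\{L(K)<\theta\le U(K)\mid\theta\},\quad C_U(\theta)=\Pr\{L(K)\le\theta<U(K)\mid\theta\},\quad C(\theta)=\Pr\{L(K)\le\theta\le U(K)\mid\theta\}.$$ Then: (1) the minimum of $\Pr\{L(K)<\theta<U(K)\mid\theta\}$ with respect to $\theta\in[a,b]$ is attained at the set $\mathcal{S}_L\cup\mathcal{S}_U\cup\{a,b\}$; (2) the infimum of $\Pr\{L(K)\le\theta\le U(K)\mid\theta\}$ with respect to $\theta\in[a,b]$ is equal to the minimum of the set $$\{C_L(\theta):\theta\in\mathcal{S}_L\}\cup\{C_U(\theta):\theta\in\mathcal{S}_U\}\cup\{C(a),\,C_U(a),\,C(b),\,C_L(b)\};$$ (3) moreover, for both the open random interval $(L(K),U(K))$ and the closed random interval $[L(K),U(K)]$, the coverage probability (that is, $\Pr\{L(K)<\theta<U(K)\mid\theta\}$, respectively $\Pr\{L(K)\le\theta\le U(K)\mid\theta\}$) is continuous and unimodal for $\theta\in(\theta',\theta'')$, where $\theta'$ and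 $\theta''$ are arbitrary consecutive distinct elements of $\mathcal{S}_L\cup\mathcal{S}_U\cup\{a,b\}$.
   Context: $\Theta$ is a set of real parameter values. $\Pr\{E\mid\theta\}$ denotes the probability of the event $E$ when the parameter of the distribution of $K$ has value $\theta$ (it is not a conditional probability). The functions $L$ and $U$ do not depend on $\theta$. The support of a random variable is the set of all possible values assumed by it. A function is unimodal on $\Theta$ if there exists $\theta^*$ such that it is non-decreasing for $\theta\in\Theta$ no greater than $\theta^*$ and non-increasing for $\theta\in\Theta$ no less than $\theta^*$; monotone functions count as unimodal (take $\theta^*$ to be the infimum or supremum of $\Theta$).
   Formalization: Parts (1) and (2) are proved assuming S_L ∪ S_U is finite, and a < b is assumed throughout; if the support points accumulate in [a,b], the minimum need not be attained at the stated set and the set in (2) may have no minimum, and (2) can fail for a = b. *)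

(* Defs.v *)
From HB Require Import structures.
From mathcomp Require Export all_boot all_order all_algebra.
From mathcomp Require Export all_classical all_reals all_analysis.

Set Implicit Arguments.
Unset Strict Implicit.
Unset Printing Implicit Defensive.

Export Order.TTheory GRing.Theory Num.Theory.
Export numFieldNormedType.Exports.

Global Open Scope classical_set_scope.
Global Open Scope ring_scope.

(* Integer-valued random variables are measurable maps into int with its
   discrete sigma-algebra; every function of int is then measurable. *)
HB.instance Definition _ := isPointed.Build int 0.
HB.instance Definition _ := @isMeasurable.Build default_measure_display
  int discrete_measurable discrete_measurable0
  discrete_measurableC discrete_measurableU.

Section Unimodal.
Variable R : realType.

(* The mode is an extended real, so that monotone functions are unimodal even
   when D is unbounded (the mode is then the infimum or supremum of D).  It is
   not required to belong to D. *)
Definition unimodal_on (D : set R) (f : R -> R) : Prop :=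
  exists t : \bar R,
    (forall x y, D x -> D y -> x <= y -> (y%:E <= t)%E -> f x <= f y) /\
    (forall x y, D x -> D y -> x <= y -> (t <= x%:E)%E -> f y <= f x).

Definition is_minimum (A : set R) (m : R) : Prop := A m /\ lbound A m.

Definition consecutive (A : set R) (x y : R) : Prop :=
  [/\ A x, A y, x < y & forall z, A z -> ~ (x < z < y)].

End Unimodal.

Section Coverage.
Context {R : realType} {d : measure_display} {T : measurableType d}.
(* P t is the probability measure in force when the parameter equals t; only
   its values on the parameter set Theta matter. *)
Variable P : R -> probability T R.

Definition Pr (E : set T) (t : R) : R := fine (P t E).

(* Possible values of a discrete random variable X: those assumed with positive
   probability for at least one admissible parameter value. *)
Definition support (Theta : set R) (X : T -> R) : set R :=
  [set x | exists2 t, Theta t & 0 < Pr (X @^-1` [set x]) t].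

Variables (K : T -> int) (L U : int -> R).

Definition cov_open (t : R) : R :=
  Pr [set w | L (K w) < t < U (K w)] t.

Definition cov_L (t : R) : R :=
  Pr [set w | L (K w) < t <= U (K w)] t.

Definition cov_U (t : R) : R :=
  Pr [set w | L (K w) <= t < U (K w)] t.

Definition cov_closed (t : R) : R :=
  Pr [set w | L (K w) <= t <= U (K w)] t.

End Coverage.

(* Main.v *)
Require Import Defs.
From mathcomp Require Import lra.

(* K takes countably many values, so the values of L(K) and U(K) outside their
   supports can be ignored under every admissible parameter.  If no support
   point lies strictly between x and y, then for any v in ]x, y[ the function
   g(theta) = Pr{L(K) <= v <= U(K) | theta} coincides with both coverage
   probabilities on ]x, y[, and it takes the values C_U(x) and C_L(y) at the end
   points.  As g is continuous and unimodal, its infimum over ]x, y[ is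
   min(C_U(x), C_L(y)).  At a point of S off the support of L(K) (resp. U(K)),
   C_L (resp. C_U) equals C, which dominates the other one; hence only the values
   of C_L on S_L and of C_U on S_U matter. *)

Set Implicit Arguments.
Unset Strict Implicit.
Unset Printing Implicit Defensive.

Lemma finite_set_argmin (R : realType) (I : choiceType) (A : set I) (f : I -> R) :
  finite_set A -> A !=set0 ->
  exists2 x, A x & forall y, A y -> f x <= f y.
Proof.
move=> /finite_seqP[s ->{A}]; elim: s => [[]//|x [|z s] IHs] _.
  by exists x; rewrite /= ?mem_head// => y; rewrite inE => /eqP ->.
case: IHs => [|w ws wmin]; first by exists z; rewrite /= mem_head.
have [xw|wx] := leP (f x) (f w).
- exists x; rewrite /= ?mem_head// => y; rewrite inE => /predU1P[->//|].
  by move=> /wmin; exact: le_trans.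
- exists w => [|y]; rewrite /= inE; first by rewrite ws orbT.
  by move=> /predU1P[->|/wmin//]; exact: ltW.
Qed.

(** * Events determined by an integer-valued random variable, up to null atoms *)

Section Preimages.
Context {d : measure_display} {T : measurableType d} {R : realType}.
Implicit Types (mu : {measure set T -> \bar R}) (K : {mfun T >-> int}).

(** The integers are countable, so the event is covered by countably many null fibres of [K]. *)
Lemma negligible_preimage mu K (A : set int) :
  (forall k, A k -> mu (K @^-1` [set k]) = 0) -> mu (K @^-1` A) = 0.
Proof.
move=> A0; apply: measure_negligible; first exact: measurable_funPTI.
(* The fibres are enumerated along [unpickle]; an index that codes no integer, or an integer outside
   [A], contributes the empty set. *)
pose F n := if unpickle n is Some k then
  (if `[< A k >] then K @^-1` [set k] else set0) else set0.
apply: (@negligibleS _ _ _ _ (\bigcup_n F n)).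
  move=> w Aw; exists (pickle (K w)) => //.
  by rewrite /F pickleK asboolT.
apply: negligible_bigcup => n; rewrite /F.
case: (unpickle n) => [k|]; last exact: negligible_set0.
case: asboolP => [Ak|_]; last exact: negligible_set0.
apply/negligibleP; last exact: A0.
exact: measurable_funPTI.
Qed.

Lemma eq_preimage_ae mu K (A B : set int) :
  (forall k, mu (K @^-1` [set k]) <> 0 -> A k <-> B k) ->
  mu (K @^-1` A) = mu (K @^-1` B).
Proof.
(* By symmetry, both [A] and [B] may be compared with their intersection. *)
suff H (C D : set int) :
    (forall k, mu (K @^-1` [set k]) <> 0 -> C k -> D k) ->
    mu (K @^-1` C) = mu (K @^-1` (C `&` D)).
  move=> AB; rewrite (H A B); last by move=> k /AB[].
  by rewrite setIC -(H B A)// => k /AB[].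
(* Split [C] into [C] inside [D] and [C] outside [D]; the latter contains only null atoms. *)
move=> CD; rewrite -[in LHS](setUIDK C D) preimage_setU measureU0 //;
  try exact: measurable_funPTI.
apply: negligible_preimage => k [Ck nDk]; apply: contrapT => k0.
exact/nDk/CD.
Qed.

End Preimages.

(** * Coverage probabilities and the supports of the two limits *)

Section CoverageProbability.
Context {R : realType} {d : measure_display} {T : measurableType d}.
Context {Theta : set R} {P : R -> probability T R} {K : {mfun T >-> int}}.
Context {L U : int -> R}.

Lemma le_Pr_preimage (A B : set int) t : A `<=` B ->
  Pr P (K @^-1` A) t <= Pr P (K @^-1` B) t.
Proof.
move=> AB; rewrite /Pr fine_le ?fin_num_measure//; try exact: measurable_funPTI.
apply: le_measure; rewrite ?inE; try exact: measurable_funPTI.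
exact: preimage_subset.
Qed.

(** The fibre of [K] over [k] lies in the event that [f \o K] takes the value [f k], so its positive
    mass is inherited. *)
Lemma atom_support (f : int -> R) t k : Theta t ->
  P t (K @^-1` [set k]) <> 0 -> support P Theta (f \o K) (f k).
Proof.
move=> Tt /eqP Pk; exists t => //.
apply: (@lt_le_trans _ _ (Pr P (K @^-1` [set k]) t)).
  by rewrite fine_gt0// lt0e Pk measure_ge0 ltey_eq fin_num_measure//;
    exact: measurable_funPTI.
rewrite (_ : (f \o K) @^-1` _ = K @^-1` (f @^-1` [set f k]))//.
by apply: le_Pr_preimage => _ ->.
Qed.

Lemma eq_Pr_support (A B : set int) t : Theta t ->
  (forall k, support P Theta (L \o K) (L k) -> support P Theta (U \o K) (U k) ->
    A k <-> B k) ->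
  Pr P (K @^-1` A) t = Pr P (K @^-1` B) t.
Proof.
move=> Tt AB; congr fine; apply: eq_preimage_ae => k Pk.
by apply: AB; exact: atom_support Pk.
Qed.

Lemma cov_open_le_L t : cov_open P K L U t <= cov_L P K L U t.
Proof.
apply: (@le_Pr_preimage [set k | L k < t < U k] [set k | L k < t <= U k]).
by move=> k /andP[Lt /ltW tU]; apply/andP.
Qed.

Lemma cov_open_le_U t : cov_open P K L U t <= cov_U P K L U t.
Proof.
apply: (@le_Pr_preimage [set k | L k < t < U k] [set k | L k <= t < U k]).
by move=> k /andP[/ltW Lt tU]; apply/andP.
Qed.

Lemma cov_L_le_closed t : cov_L P K L U t <= cov_closed P K L U t.
Proof.
apply: (@le_Pr_preimage [set k | L k < t <= U k] [set k | L k <= t <= U k]).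
by move=> k /andP[/ltW Lt tU]; apply/andP.
Qed.

Lemma cov_U_le_closed t : cov_U P K L U t <= cov_closed P K L U t.
Proof.
apply: (@le_Pr_preimage [set k | L k <= t < U k] [set k | L k <= t <= U k]).
by move=> k /andP[Lt /ltW tU]; apply/andP.
Qed.

(** The two events differ only where [L k] equals [t], which never happens on an atom of positive
    mass. *)
Lemma cov_L_notin_support t : Theta t -> ~ support P Theta (L \o K) t ->
  cov_L P K L U t = cov_closed P K L U t.
Proof.
move=> Tt St.
apply: (@eq_Pr_support [set k | L k < t <= U k] [set k | L k <= t <= U k]) => //.
move=> k SL _ /=; rewrite [L k < t]lt_neqAle.
by have [Lt|//] := eqVneq (L k) t; rewrite Lt in SL.
Qed.

Lemma cov_U_notin_support t : Theta t -> ~ support P Theta (U \o K) t ->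
  cov_U P K L U t = cov_closed P K L U t.
Proof.
move=> Tt St.
apply: (@eq_Pr_support [set k | L k <= t < U k] [set k | L k <= t <= U k]) => //.
move=> k _ SU /=; rewrite [t < U k]lt_neqAle eq_sym.
by have [Ut|//] := eqVneq (U k) t; rewrite Ut in SU.
Qed.

(** * Coverage on an interval free of support points *)

Section Gap.
Context {x y v : R}.
Hypothesis xyTheta : `[x, y]%classic `<=` Theta.
Hypothesis gapL : forall z, x < z < y -> ~ support P Theta (L \o K) z.
Hypothesis gapU : forall z, x < z < y -> ~ support P Theta (U \o K) z.
Hypothesis xvy : x < v < y.

Let cov := Pr P [set w | L (K w) <= v <= U (K w)].

(** A support value lies weakly on one side of the whole gap, so it compares in the same way with
    every interior point. The lemmas below then reduce to linear arithmetic. *)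
Let gapP {f z} : (forall z, x < z < y -> ~ support P Theta (f \o K) z) ->
  support P Theta (f \o K) z -> (z <= x) || (y <= z).
Proof.
move=> gap Sz; rewrite leNgt [y <= z]leNgt -negb_and.
by apply/negP => /gap.
Qed.

Lemma gap_cov_closed z : x < z < y -> cov_closed P K L U z = cov z.
Proof.
move=> /andP[xz zy]; have /andP[xv vy] := xvy.
apply: (@eq_Pr_support [set k | L k <= z <= U k] [set k | L k <= v <= U k]).
  by apply: xyTheta; rewrite /= in_itv/= !ltW.
move=> k /(gapP gapL) Lk /(gapP gapU) Uk /=.
by split=> /andP[? ?]; apply/andP; split; lra.
Qed.

Lemma gap_cov_open z : x < z < y -> cov_open P K L U z = cov z.
Proof.
move=> /andP[xz zy]; have /andP[xv vy] := xvy.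
apply: (@eq_Pr_support [set k | L k < z < U k] [set k | L k <= v <= U k]).
  by apply: xyTheta; rewrite /= in_itv/= !ltW.
move=> k /(gapP gapL) Lk /(gapP gapU) Uk /=.
by split=> /andP[? ?]; apply/andP; split; lra.
Qed.

(** For [L k] and [U k] outside the gap, [L k <= x] means [L k <= v], and [x < U k] forces
    [y <= U k], that is, [v <= U k]. Strictness is needed on the side of [U] only, which is why
    [cov_U] is the value at a left end. *)
Lemma gap_cov_U : cov_U P K L U x = cov x.
Proof.
have /andP[xv vy] := xvy.
apply: (@eq_Pr_support [set k | L k <= x < U k] [set k | L k <= v <= U k]).
  by apply: xyTheta; rewrite /= in_itv/= lexx (ltW (lt_trans xv vy)).
move=> k /(gapP gapL) Lk /(gapP gapU) Uk /=.
by split=> /andP[? ?]; apply/andP; split; lra.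
Qed.

Lemma gap_cov_L : cov_L P K L U y = cov y.
Proof.
have /andP[xv vy] := xvy.
apply: (@eq_Pr_support [set k | L k < y <= U k] [set k | L k <= v <= U k]).
  by apply: xyTheta; rewrite /= in_itv/= lexx (ltW (lt_trans xv vy)).
move=> k /(gapP gapL) Lk /(gapP gapU) Uk /=.
by split=> /andP[? ?]; apply/andP; split; lra.
Qed.

End Gap.
End CoverageProbability.

(** * Unimodality, one-sided limits and neighbours in finite sets of reals *)

Section RealFunctions.
Context {R : realType}.
Implicit Types (f g : R -> R) (D E : set R).

(** Quasi-concavity: up to the mode [f z] dominates [f x], and beyond it [f y]. *)
Lemma unimodal_on_ge D f x y z m : unimodal_on D f -> D x -> D y -> D z ->
  x <= z <= y -> m <= f x -> m <= f y -> m <= f z.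
Proof.
move=> [t [ndf nif]] Dx Dy Dz /andP[xz zy] mx my.
have [zt|/ltW tz] := leP z%:E t.
- exact: le_trans mx (ndf _ _ Dx Dz xz zt).
- exact: le_trans my (nif _ _ Dz Dy zy tz).
Qed.

Lemma eq_unimodal_on D E f g : E `<=` D -> {in E, f =1 g} ->
  unimodal_on D f -> unimodal_on E g.
Proof.
move=> ED fg [t [ndf nif]]; exists t.
by split=> x y Ex Ey xy txy; rewrite -!fg ?inE//; auto.
Qed.

Lemma eq_continuous_within D E f g : E `<=` D -> {in E, f =1 g} ->
  {within D, continuous f} -> {within E, continuous g}.
Proof.
move=> ED fg /(continuous_subspaceW ED).
exact: subspace_eq_continuous.
Qed.

(** A lower bound survives the one-sided limits at both ends. *)
Lemma continuous_within_ge f x y m : x < y ->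
  {within `[x, y], continuous f} -> (forall z, x < z < y -> m <= f z) ->
  m <= f x /\ m <= f y.
Proof.
move=> xy /(continuous_within_itvP _ xy)[_ fx fy] mf; split.
- apply: cvgr_to_ge fx _; near=> z; apply: mf; apply/andP; split; near: z.
    exact: nbhs_right_gt.
  exact: nbhs_right_lt.
- apply: cvgr_to_ge fy _; near=> z; apply: mf; apply/andP; split; near: z.
    exact: nbhs_left_gt.
  exact: nbhs_left_lt.
Unshelve. all: by end_near. Qed.

Lemma finite_consecutive_succ (A : set R) x y : finite_set A -> A x -> A y ->
  x < y -> exists z, consecutive A x z.
Proof.
move=> Afin Ax Ay xy.
have [||z [Az xz] zmin] := @finite_set_argmin R _ (A `&` `]x, +oo[) id.
- exact: finite_setIl.
- by exists y; split=> //=; rewrite in_itv/= xy.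
exists z; split=> //; first by move: xz; rewrite /= in_itv/= andbT.
move=> w Aw /andP[xw]; apply/negP; rewrite -leNgt.
by apply: zmin; split=> //=; rewrite in_itv/= xw.
Qed.

Lemma finite_consecutive_pred (A : set R) x y : finite_set A -> A x -> A y ->
  x < y -> exists z, consecutive A z y.
Proof.
move=> Afin Ax Ay xy.
(* Minimising the opposite yields the largest element below [y]. *)
have [||z [Az zy] zmax] := @finite_set_argmin R _ (A `&` `]-oo, y[) -%R.
- exact: finite_setIl.
- by exists x; split=> //=; rewrite in_itv/= xy.
exists z; split=> //.
move=> w Aw /andP[zw wy]; move: zw; apply/negP; rewrite -leNgt -lerN2.
by apply: zmax; split=> //=; rewrite in_itv/= wy.
Qed.

Lemma finite_consecutive_between (A : set R) x y t : finite_set A ->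
  A x -> A y -> ~ A t -> x <= t <= y ->
  exists t1 t2, consecutive A t1 t2 /\ t1 < t < t2.
Proof.
move=> Afin Ax Ay At /andP[xt ty].
have {}xt : x < t.
  by rewrite lt_neqAle xt andbT; apply/eqP => xt'; apply: At; rewrite -xt'.
have {}ty : t < y.
  by rewrite lt_neqAle ty andbT; apply/eqP => ty'; apply: At; rewrite ty'.
(* Adjoin [t] and take its two neighbours. They belong to [A], and they are consecutive there
   because only [t] separated them. *)
have AUfin : finite_set (A `|` [set t]) by rewrite finite_setU.
have [||t1 [At1 _ t1t t1max]] := finite_consecutive_pred AUfin _ _ xt.
- by left.
- by right.
have [||t2 [_ At2 tt2 t2min]] := finite_consecutive_succ AUfin _ _ ty.
- by right.
- by left.
exists t1, t2; rewrite t1t tt2; split=> //; split.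
- by case: At1 => // t1E; move: t1t; rewrite t1E ltxx.
- by case: At2 => // t2E; move: tt2; rewrite t2E ltxx.
- exact: lt_trans tt2.
move=> z Az /andP[t1z zt2]; have [zt|tz|zt] := ltgtP z t.
- by apply: (t1max z); [left|rewrite t1z].
- by apply: (t2min z); [left|rewrite tz].
- by apply: At; rewrite -zt.
Qed.

End RealFunctions.

(** * The coverage theorem *)

Theorem theorem7 (R : realType) (d : measure_display) (T : measurableType d)
    (Theta : set R) (P : R -> probability T R) (K : {mfun T >-> int})
    (L U : int -> R) (a b : R)
    (hab : a < b) (habTheta : `[a, b]%classic `<=` Theta)
    (hcov : forall v : R, Theta v ->
      let g := Pr P [set w | L (K w) <= v <= U (K w)] in
      {within Theta, continuous g} /\ unimodal_on Theta g) :
  let SL := `]a, b[%classic `&` support P Theta (L \o K) in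
  let SU := `]a, b[%classic `&` support P Theta (U \o K) in
  let S := SL `|` SU `|` [set a; b] in
  let Copen := cov_open P K L U in
  let CL := cov_L P K L U in
  let CU := cov_U P K L U in
  let C := cov_closed P K L U in
  (finite_set (SL `|` SU) ->
    (exists2 t0, S t0 & forall t, `[a, b]%classic t -> Copen t0 <= Copen t) /\
    is_minimum
      ((CL @` SL) `|` (CU @` SU) `|` [set C a; CU a; C b; CL b])
      (inf (C @` `[a, b]%classic))) /\
  (forall t1 t2, consecutive S t1 t2 ->
    [/\ {within `]t1, t2[%classic, continuous Copen},
        unimodal_on `]t1, t2[%classic Copen,
        {within `]t1, t2[%classic, continuous C} &
        unimodal_on `]t1, t2[%classic C]).
Proof.
move=> SL SU S Copen CL CU C.
have Sab t : S t -> a <= t <= b.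
  move=> [[[+ _]|[+ _]]|[->|->]]; rewrite /= ?in_itv/= ?lexx ?(ltW hab)//;
  by move=> /andP[/ltW -> /ltW ->].
have abTheta t : a <= t <= b -> Theta t.
  by move=> abt; apply: habTheta; rewrite /= in_itv.
have gap t1 t2 : consecutive S t1 t2 ->
    [/\ `[t1, t2]%classic `<=` Theta,
        forall z, t1 < z < t2 -> ~ support P Theta (L \o K) z &
        forall z, t1 < z < t2 -> ~ support P Theta (U \o K) z].
  move=> [/Sab/andP[at1 _] /Sab/andP[_ t2b] t12 St12].
  have abz z : t1 < z < t2 -> `]a, b[%classic z.
    move=> /andP[t1z zt2]; rewrite /= in_itv/=.
    by rewrite (le_lt_trans at1 t1z) (lt_le_trans zt2 t2b).
  split=> [z|z zt Sz|z zt Sz].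
  - rewrite /= in_itv/= => /andP[t1z zt2]; apply: abTheta.
    by rewrite (le_trans at1 t1z) (le_trans zt2 t2b).
  - by apply: (St12 z) => //; left; left; split=> //; exact: abz.
  - by apply: (St12 z) => //; left; right; split=> //; exact: abz.
have mid (t1 t2 : R) : t1 < t2 -> t1 < (t1 + t2) / 2 < t2.
  by move=> t12; apply/andP; split; lra.
pose g v := Pr P [set w | L (K w) <= v <= U (K w)].
have gP t1 t2 v : consecutive S t1 t2 -> t1 < v < t2 ->
    [/\ {within Theta, continuous (g v)}, unimodal_on Theta (g v),
        forall z, t1 < z < t2 -> Copen z = g v z /\ C z = g v z,
        CU t1 = g v t1 & CL t2 = g v t2].
  move=> St12 vt; have [t12Theta SLt SUt] := gap _ _ St12.
  have /hcov[gc gu] : Theta v.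
    by apply: t12Theta; rewrite /= in_itv/=; move/andP: vt => [/ltW-> /ltW->].
  split=> //; first (move=> z zt; split).
  - exact: (gap_cov_open t12Theta SLt SUt vt zt).
  - exact: (gap_cov_closed t12Theta SLt SUt vt zt).
  - exact: (gap_cov_U t12Theta SLt SUt vt).
  - exact: (gap_cov_L t12Theta SLt SUt vt).
have sTheta t1 t2 t : consecutive S t1 t2 -> t1 <= t <= t2 -> Theta t.
  move=> [/Sab/andP[at1 _] /Sab/andP[_ t2b] _ _] /andP[t1t tt2].
  by apply: abTheta; rewrite (le_trans at1 t1t) (le_trans tt2 t2b).
have inner t1 t2 z m : consecutive S t1 t2 -> t1 < z < t2 ->
    m <= CU t1 -> m <= CL t2 -> m <= Copen z /\ m <= C z.
  move=> St12 zt; have [_ gu /(_ _ zt)[-> ->] -> ->] := gP _ _ _ St12 zt.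
  have /andP[t1z zt2] := zt; have t12 := lt_trans t1z zt2.
  move=> m1 m2; split; apply: (unimodal_on_ge gu _ _ _ _ m1 m2);
    by [apply: (sTheta _ _ _ St12); rewrite ?lexx ?ltW|rewrite !ltW].
(* Conversely, continuity carries a lower bound on [C] from the interior of a gap to its ends; any
   interior [v] would do, and the midpoint is chosen. *)
have endpoints t1 t2 m : consecutive S t1 t2 ->
    (forall z, a <= z <= b -> m <= C z) -> m <= CU t1 /\ m <= CL t2.
  move=> St12 mC; have [St1 St2 t12 _] := St12.
  have [gc _ gE -> ->] := gP _ _ _ St12 (mid _ _ t12).
  apply: continuous_within_ge => //.
    apply: continuous_subspaceW gc => t; rewrite /= in_itv/=.
    exact: sTheta St12.
  move=> z zt; have [_ <-] := gE _ zt; apply: mC.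
  have /andP[t1z zt2] := zt.
  have [/andP[at1 _] /andP[_ t2b]] := (Sab _ St1, Sab _ St2).
  by rewrite (le_trans at1 (ltW t1z)) (le_trans (ltW zt2) t2b).
have Sa : S a by right; left.
have Sb : S b by right; right.
split; last first.
  move=> t1 t2 St12; have [_ _ t12 _] := St12.
  have [gc gu gE _ _] := gP _ _ _ St12 (mid _ _ t12).
  have sub : `]t1, t2[%classic `<=` Theta.
    move=> t; rewrite /= in_itv/= => /andP[/ltW t1t /ltW tt2].
    by apply: (sTheta _ _ _ St12); rewrite t1t.
  have gO : {in `]t1, t2[%classic, g ((t1 + t2) / 2) =1 Copen}.
    by move=> t; rewrite inE/= in_itv/= => /gE[].
  have gC : {in `]t1, t2[%classic, g ((t1 + t2) / 2) =1 C}.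
    by move=> t; rewrite inE/= in_itv/= => /gE[].
  split.
  - exact: eq_continuous_within sub gO gc.
  - exact: eq_unimodal_on sub gO gu.
  - exact: eq_continuous_within sub gC gc.
  - exact: eq_unimodal_on sub gC gu.
(* Finiteness provides minimisers over [S], and places each point of [[a, b]] outside [S] in a
   gap. *)
move=> SLUfin.
have Sfin : finite_set S by rewrite finite_setU; split=> //; exact: finite_set2.
split.
  have [|t0 St0 t0min] := finite_set_argmin Copen Sfin; first by exists a.
  exists t0 => // t; rewrite /= in_itv/= => abt.
  have [/t0min//|nSt] := pselect (S t).
  have [t1 [t2 [St12 t12]]] := finite_consecutive_between Sfin Sa Sb nSt abt.
  have [St1 St2 _ _] := St12.
  apply: (inner _ _ _ _ St12 t12 _ _).1.
  - exact: le_trans (t0min _ St1) (cov_open_le_U _).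
  - exact: le_trans (t0min _ St2) (cov_open_le_L _).
set A := (X in is_minimum X _).
have [||m Am mmin] := @finite_set_argmin R _ A id.
- move: SLUfin; rewrite finite_setU => -[SLfin SUfin].
  rewrite !finite_setU; do ?split; by [exact: finite_image|exact: finite_set1].
- by exists (C a); right; left; left; left.
have mCa : m <= C a by apply: mmin; right; left; left; left.
have mCb : m <= C b by apply: mmin; right; left; right.
have mSL t : SL t -> m <= CL t.
  by move=> SLt; apply: mmin; left; left; exists t.
have mSU t : SU t -> m <= CU t.
  by move=> SUt; apply: mmin; left; right; exists t.
have mSC t : S t -> m <= C t.
  move=> [[/mSL mt|/mSU mt]|[->|->]] //.
  - exact: le_trans mt (cov_L_le_closed _).
  - exact: le_trans mt (cov_U_le_closed _).
(* Either [CU t] is listed in [A], or [t] is off the support of [U \o K] and [CU t] equals [C t]. *)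
have mCU t : S t -> t < b -> m <= CU t.
  move=> St tb; have [->|ta] := eqVneq t a.
    by apply: mmin; right; left; left; right.
  have [/mSU//|nSU] := pselect (SU t).
  rewrite [CU t](@cov_U_notin_support _ _ _ Theta); first exact: mSC.
    exact/abTheta/Sab.
  move=> SUt; apply: nSU; split=> //.
  rewrite /= in_itv/= tb andbT lt_neqAle eq_sym ta.
  by have /andP[] := Sab _ St.
have mCL t : S t -> a < t -> m <= CL t.
  move=> St ta; have [->|tb] := eqVneq t b.
    by apply: mmin; right; right.
  have [/mSL//|nSL] := pselect (SL t).
  rewrite [CL t](@cov_L_notin_support _ _ _ Theta); first exact: mSC.
    exact/abTheta/Sab.
  move=> SLt; apply: nSL; split=> //; rewrite /= in_itv/= ta lt_neqAle tb.
  by have /andP[] := Sab _ St.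
have mC t : a <= t <= b -> m <= C t.
  move=> abt; have [/mSC//|nSt] := pselect (S t).
  have [t1 [t2 [St12 t12]]] := finite_consecutive_between Sfin Sa Sb nSt abt.
  have [St1 St2 lt12 _] := St12.
  have /andP[at1 _] := Sab _ St1; have /andP[_ t2b] := Sab _ St2.
  apply: (inner _ _ _ _ St12 t12 _ _).2.
  - by apply: mCU => //; exact: lt_le_trans lt12 t2b.
  - by apply: mCL => //; exact: le_lt_trans at1 lt12.
(* For the reverse inequality, the infimum must bound every element of [A] from below. Here [m]
   certifies that the image of [C] is bounded below, without which [inf] would carry no
   information. *)
have infC t : a <= t <= b -> inf (C @` `[a, b]%classic) <= C t.
  move=> abt; apply: ge_inf; last by exists t; rewrite //= in_itv.
  by exists m => _ [z + <-]; rewrite /= in_itv/=; exact: mC.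
(* Since [t < b], a gap of [S] starts at [t], and [CU t] is the limit of [C] from inside it. *)
have infCU t : S t -> t < b -> inf (C @` `[a, b]%classic) <= CU t.
  move=> St tb; have [z tz] := finite_consecutive_succ Sfin St Sb tb.
  exact: (endpoints _ _ _ tz infC).1.
have infCL t : S t -> a < t -> inf (C @` `[a, b]%classic) <= CL t.
  move=> St ta; have [z zt] := finite_consecutive_pred Sfin Sa St ta.
  exact: (endpoints _ _ _ zt infC).2.
have infA : lbound A (inf (C @` `[a, b]%classic)).
  move=> _ [[[t SLt <-]|[t SUt <-]]|[[[->|->]|->]|->]].
  - apply: infCL; first by left; left.
    by case: SLt; rewrite /= in_itv/= => /andP[].
  - apply: infCU; first by left; right.
    by case: SUt; rewrite /= in_itv/= => /andP[].
  - by apply: infC; rewrite lexx ltW.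
  - exact: infCU.
  - by apply: infC; rewrite lexx ltW.
  - exact: infCL.
suff infE : inf (C @` `[a, b]%classic) = m by split; rewrite infE// -infE.
apply/eqP; rewrite eq_le infA//= lb_le_inf//.
  by exists (C a), a; rewrite //= in_itv/= lexx ltW.
by move=> _ [t + <-]; rewrite /= in_itv/=; exact: mC.
Qed.
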